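(* Let $k\geqslant 3$ and $1\leqslant t\leqslant k-2$ be integers, let $n\geqslant k^4$, and let $\mathcal{F}\subseteq\binom{[n]}{k}$ be a $t$-intersecting family. Then $N_{3,t}(\mathcal{F})\leqslant N_{3,t}(\mathcal{G}_{2,t})$, and equality holds if and only if, up to isomorphism, $\mathcal{G}_{2,t}\subseteq\mathcal{F}\subseteq\mathcal{G}'_{2,t}$.
   Context: $[n]=\{1,\dots,n\}$ and $\binom{[n]}{k}$ is the family of all $k$-element subsets of $[n]$. A family $\mathcal{F}$ is $t$-intersecting if $|F\cap F'|\geqslant t$ for all $F,F'\in\mathcal{F}$; more generally it is $r$-wise $t$-intersecting if $|F_1\cap\cdots\cap F_r|\geqslant t$ for all $F_1,\dots,F_r\in\mathcal{F}$. A $(r+1,t)$-triangle is a family $\{T_1,\dots,T_{r+1}\}$ of $r+1$ sets which is $r$-wise $t$-intersecting and satisfies $|T_1\cap\cdots\cap T_{r+1}|\leqslant t-1$. For a family $\mathcal{F}$, $N_{r+1,t}(\mathcal{F})$ denotes the number of $(r+1)$-element subfamilies of $\mathcal{F}$ that are $(r+1,t)$-triangles. Define $\mathcal{G}_{r,t}=\{F\in\binom{[n]}{k}: |F\cap[r+t]|=r+t-1\}$ and $\mathcal{G}'_{r,t}=\{F\in\binom{[n]}{k}: |F\cap[r+t]|\geqslant r+t-1\}$. Two families are isomorphic if one is obtained from the other by a permutation of $[n]$. *)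

(* Defs.v *)
From mathcomp Require Import all_boot all_fingroup.

Set Implicit Arguments.
Unset Strict Implicit.
Unset Printing Implicit Defensive.

(* The ground set [n] = {1, ..., n} is 'I_n, so that element i of [n] is the
   ordinal of value i - 1. *)

Definition init_seg (n m : nat) : {set 'I_n} := [set i : 'I_n | i < m].

Definition ksubsets (n k : nat) : {set {set 'I_n}} :=
  [set A : {set 'I_n} | #|A| == k].

Definition t_intersecting (T : finType) (t : nat) (F : {set {set T}}) : bool :=
  [forall A in F, forall B in F, t <= #|A :&: B|].

(* The r members need not be distinct. *)
Definition rwise_t_intersecting (T : finType) (r t : nat)
    (F : {set {set T}}) : bool :=
  [forall f : {ffun 'I_r -> {set T}},
     [forall i, f i \in F] ==> (t <= #|\bigcap_(i < r) f i|)].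

(* The (r+1,t)-triangles. The condition "at most t - 1" is written "< t" to
   avoid truncated subtraction. *)
Definition triangle (T : finType) (r t : nat) (S : {set {set T}}) : bool :=
  [&& #|S| == r.+1, rwise_t_intersecting r t S & #|\bigcap_(A in S) A| < t].

(* N_{r+1,t}(F); note the argument is r, not r + 1. *)
Definition num_triangles (T : finType) (r t : nat) (F : {set {set T}}) : nat :=
  #|[set S : {set {set T}} | (S \subset F) && triangle r t S]|.

Definition G_fam (n k r t : nat) : {set {set 'I_n}} :=
  [set A in ksubsets n k | #|A :&: init_seg n (r + t)| == r + t - 1].

Definition G'_fam (n k r t : nat) : {set {set 'I_n}} :=
  [set A in ksubsets n k | r + t - 1 <= #|A :&: init_seg n (r + t)|].

Definition isomorphic (T : finType) (F F' : {set {set T}}) : Prop :=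
  exists s : {perm T}, F' = [set s @: A | A : {set T} in F].

(* Main.v *)
(** Write F_U for the members of F containing U. A set W with |W ∩ A| >= t for
    all A in F is called a cover. If U is not a cover, some C in F meets U in
    fewer than t points, so every member of F_U uses a point of C \ U and
    |F_U| <= k max_x |F_{U+x}|. Let m and w count the k-sets through a fixed
    (t+1)-set and a fixed (t+2)-set; since n >= k^4, k^2 (k + 2) w <= m. The
    extremal family has more than t(t+1)(t+2) m^3 / 2 ordered triangles.

    If every cover has more than t + 1 points, starting from the t-subsets of a
    minimum cover and extending repeatedly gives 2|F| <= (t+1) m, which is too
    few. Otherwise call a (t+1)-set S heavy if |F_S| > k w. Heavy sets are covers
    and pairwise t-intersecting. Three heavy sets without a common t-set lie in
    a (t+2)-set Y, and then every member of F meets Y in at least t + 1 points: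
    F is as in the equality case. If any three heavy sets share a t-set, every
    triangle has a member containing no heavy set, at most m / 3 members are
    like that, and counting by the number of heavy sets gives too few triangles. *)

Require Import Defs.
From mathcomp Require Import all_boot all_fingroup.
From mathcomp Require Import zify.

Set Implicit Arguments.
Unset Strict Implicit.
Unset Printing Implicit Defensive.

(** * Stars, ordered triangles, and crude bounds on their number *)

Section Counting.

Variable T : finType.
Implicit Types (A B C U : {set T}) (F L S : {set {set T}}).

Lemma t_intersectingP t F :
  reflect {in F &, forall A B, t <= #|A :&: B|} (t_intersecting t F).
Proof.
apply: (iffP forall_inP) => [h A B FA FB|h A FA].
  exact: (forall_inP (h A FA)).
by apply/forall_inP => B FB; apply: h.
Qed.

Lemma leq_card_bigcup (I : finType) (P : pred I) (f : I -> {set {set T}}) b :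
  (forall i, P i -> #|f i| <= b) -> #|\bigcup_(i | P i) f i| <= #|P| * b.
Proof.
move=> h; have -> : #|P| * b = \sum_(i | P i) b by rewrite sum_nat_const.
apply: (@leq_trans (\sum_(i | P i) #|f i|)); last exact: leq_sum.
elim/big_rec2: _ => [|i m X _ le_Xm]; first by rewrite cards0.
by rewrite (leq_trans (leq_card_setU _ _)) ?leq_add2l.
Qed.

Lemma card_supersets k U : #|U| <= k ->
  #|[set A : {set T} | (#|A| == k) && (U \subset A)]| =
  'C(#|T| - #|U|, k - #|U|).
Proof.
move=> leUk; have -> : #|T| - #|U| = #|~: U| by rewrite [RHS]cardsCs setCK.
rewrite -cards_draws.
rewrite -(card_in_imset (f := fun A => A :\: U)); last first.
  move=> A B; rewrite !inE => /andP[_ UA] /andP[_ UB] eqD.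
  by rewrite -(setID A U) -(setID B U) eqD (setIidPr UA) (setIidPr UB).
apply: eq_card => B; rewrite !inE; apply/imsetP/andP => [[A]|[BU /eqP cB]].
  rewrite !inE => /andP[/eqP cA UA] ->; split.
    by rewrite setDE subsetIr.
  by rewrite cardsD (setIidPr UA) cA.
have dUB : U :&: B = set0 by apply/eqP; rewrite setI_eq0 disjoint_sym disjoints_subset.
exists (U :|: B).
  by rewrite inE subsetUl cardsU dUB cards0 cB subn0 subnKC ?eqxx.
rewrite setDUl setDv set0U; apply/esym/setDidPl.
by rewrite disjoints_subset.
Qed.

Definition star F U := [set A in F | U \subset A].

Lemma card_star_binomial k F U :
  (forall A, A \in F -> #|A| = k) -> #|U| <= k ->
  #|star F U| <= 'C(#|T| - #|U|, k - #|U|).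
Proof.
move=> cF leUk; rewrite -card_supersets //; apply: subset_leq_card.
by apply/subsetP => A; rewrite !inE => /andP[/cF -> ->]; rewrite eqxx.
Qed.

(** [U] supplies fewer than [t] of the points a member of the star shares with [C], so the member
    contains one of the at most [k] points of [C :\: U]. [C] need not lie in [F], so that heavy sets
    can also play its role. *)
Lemma card_star_extend k t b F U C :
  #|C| <= k -> #|C :&: U| < t ->
  (forall A, A \in F -> U \subset A -> t <= #|C :&: A|) ->
  (forall x, x \notin U -> #|star F (x |: U)| <= b) ->
  #|star F U| <= k * b.
Proof.
move=> cC CU hC hb.
have sub : star F U \subset \bigcup_(x in C :\: U) star F (x |: U).
  apply/subsetP => A; rewrite inE => /andP[FA UA].
  have /subsetPn[x xCA xU] : ~~ (C :&: A \subset U).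
    apply/negP => sCA; have := hC A FA UA; rewrite leqNgt => /negP; apply.
    by apply: leq_ltn_trans CU; rewrite subset_leq_card // subsetI subsetIl.
  move: xCA; rewrite inE => /andP[xC xA].
  apply/bigcupP; exists x; first by rewrite inE xU.
  by rewrite inE FA subUset sub1set xA.
apply: leq_trans (subset_leq_card sub) _.
apply: leq_trans (leq_card_bigcup (b := b) _) _.
  by move=> x; rewrite inE => /andP[xU _]; apply: hb.
rewrite leq_mul2r; apply/orP; right.
by apply: leq_trans cC; rewrite subset_leq_card // subsetDl.
Qed.

(** A nested sum can be bounded one member at a time. Distinctness is not imposed: in a
    [t]-intersecting family the condition forces it. *)
Definition ordered_triangles t F :=
  \sum_(A in F) \sum_(B in F) \sum_(C in F) (#|A :&: B :&: C| < t : nat).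

Lemma card_arrangements3 S : #|S| = 3 ->
  \sum_(A in S) \sum_(B in S :\ A) \sum_(C in S :\ A :\ B) 1 = 6.
Proof.
move=> cS; have c1 A : A \in S -> #|S :\ A| = 2.
  by move=> SA; have := cardsD1 A S; rewrite SA cS => -[]; rewrite add0n => <-.
have c2 A B : A \in S -> B \in S :\ A -> #|S :\ A :\ B| = 1.
  by move=> SA SB; have := cardsD1 B (S :\ A); rewrite SB c1 // => -[]; rewrite add0n => <-.
rewrite (eq_bigr (fun _ => 2)) => [|A SA]; first by rewrite sum_nat_const cS.
rewrite (eq_bigr (fun _ => 1)) => [|B SB]; first by rewrite sum_nat_const c1.
by rewrite sum1_card c2.
Qed.

Lemma triangle2E t F S : t_intersecting t F -> S \subset F -> #|S| = 3 ->
  triangle 2 t S = (#|\bigcap_(A in S) A| < t).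
Proof.
move=> /t_intersectingP tF SF cS; rewrite /triangle cS eqxx /=.
suff -> : rwise_t_intersecting 2 t S by [].
apply/forallP => f; apply/implyP => /forallP fS.
by rewrite big_ord_recl big_ord1 tF // (subsetP SF).
Qed.

Lemma bigcap_set3 A B C : \bigcap_(X in [set A; B; C]) X = A :&: B :&: C.
Proof. by rewrite !bigcap_setU !big_set1. Qed.

(** If two of the sets coincide, the triple intersection is an intersection of two members. *)
Lemma triangle_distinct t F A B C : t_intersecting t F ->
  A \in F -> B \in F -> C \in F -> #|A :&: B :&: C| < t ->
  [/\ A != B, A != C & B != C].
Proof.
move=> /t_intersectingP tF FA FB FC lt.
split; apply: contraTneq lt => E; rewrite -leqNgt.
- by rewrite E setIid tF.
- by rewrite E setIC setIA setIid tF.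
- by rewrite E -setIA setIid tF.
Qed.

Lemma cards3 A B C : A != B -> A != C -> B != C -> #|[set A; B; C]| = 3.
Proof.
move=> AB AC BC; rewrite setUC cardsU1 !inE cards2 AB.
by rewrite negb_or ![C == _]eq_sym AC BC.
Qed.

(** The map from a triple to its underlying set has fibres of size 6, the arrangements of three
    distinct members. *)
Lemma ordered_trianglesE t F : t_intersecting t F ->
  ordered_triangles t F = 6 * num_triangles 2 t F.
Proof.
move=> tF; pose X := [set p : {set T} * {set T} * {set T} | [&& p.1.1 \in F, p.1.2 \in F,
  p.2 \in F & #|p.1.1 :&: p.1.2 :&: p.2| < t]].
pose f (p : {set T} * {set T} * {set T}) := [set p.1.1; p.1.2; p.2].
have -> : ordered_triangles t F = \sum_(p in X) 1.
  rewrite /ordered_triangles pair_big_dep pair_big_dep /=.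
  rewrite big_mkcond [RHS]big_mkcond /=; apply: eq_bigr => -[[A B] C] _ /=.
  by rewrite inE /=; do 3 case: (_ \in F) => //=; case: (_ < t).
rewrite mulnC /num_triangles -sum1_card big_distrl /=.
rewrite (partition_big f [pred S in [set S : {set {set T}} | (S \subset F) && triangle 2 t S]]) /=; last first.
  move=> [[A B] C]; rewrite !inE /f /= => /and4P[FA FB FC lt].
  have [AB AC BC] := triangle_distinct tF FA FB FC lt.
  have sF : [set A; B; C] \subset F by rewrite !subUset !sub1set FA FB FC.
  by rewrite sF (triangle2E tF) ?cards3 // bigcap_set3.
apply: eq_bigr => S; rewrite inE => /andP[SF triS].
have cS : #|S| = 3 by move: triS => /and3P[/eqP].
move: triS; rewrite (triangle2E tF) // => ltS.
rewrite mul1n -(card_arrangements3 cS) pair_big_dep pair_big_dep /=.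
apply: eq_bigl => -[[A B] C]; rewrite !inE /f /=.
apply/andP/andP => [[/and4P[FA FB FC lt] /eqP <-]|].
  have [AB AC BC] := triangle_distinct tF FA FB FC lt.
  by rewrite !inE !eqxx /= !orbT ![C == _]eq_sym ![B == A]eq_sym AB AC BC.
case=> /andP[SA /andP[BA SB]] /and3P[CB CA SC].
have cABC : #|[set A; B; C]| = 3 by rewrite cards3 // eq_sym.
have eqS : [set A; B; C] = S.
  by apply/eqP; rewrite eqEcard !subUset !sub1set SA SB SC cABC cS.
by rewrite eqS eqxx -bigcap_set3 eqS ltS !(subsetP SF).
Qed.

(** Union bound over the position occupied by a member of [L]; the other two positions are free. *)
Lemma ordered_triangles_hit t F L :
  (forall A B C, A \in F -> B \in F -> C \in F -> #|A :&: B :&: C| < t ->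
     [|| A \in L, B \in L | C \in L]) ->
  L \subset F ->
  ordered_triangles t F <= 3 * (#|L| * #|F| ^ 2).
Proof.
move=> hL LF.
have cL : \sum_(A in F) (A \in L : nat) = #|L|.
  rewrite -sum1_card [RHS]big_mkcond [LHS]big_mkcond; apply: eq_bigr => A _.
  by case: (boolP (A \in L)) => [/(subsetP LF) -> //|_]; case: (A \in F).
apply: (@leq_trans (\sum_(A in F) \sum_(B in F) \sum_(C in F)
    ((A \in L) + (B \in L) + (C \in L)))).
  apply: leq_sum => A FA; apply: leq_sum => B FB; apply: leq_sum => C FC.
  case: ltnP => // lt; have := hL A B C FA FB FC lt.
  by case: (A \in L); case: (B \in L); case: (C \in L).
rewrite (eq_bigr (fun A => #|F| * (#|F| * (A \in L)) + 2 * (#|F| * #|L|))).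
  rewrite big_split /= -!big_distrr /= cL sum_nat_const.
  by move: #|F| #|L| => a b; nia.
move=> A FA.
rewrite (eq_bigr (fun B => #|F| * (A \in L) + #|F| * (B \in L) + #|L|)).
  rewrite !big_split /= -!big_distrr /= cL !sum_nat_const.
  by rewrite -addnA addnn -mul2n.
by move=> B FB; rewrite !big_split /= cL !sum_nat_const.
Qed.

Lemma ordered_triangles_cube t F : ordered_triangles t F <= #|F| ^ 3.
Proof.
have -> : #|F| ^ 3 = \sum_(A in F) \sum_(B in F) \sum_(C in F) 1.
  rewrite sum_nat_const; under eq_bigr => ? _ do rewrite sum1_card.
  by rewrite !sum_nat_const; move: #|F| => a; nia.
by do 3 (apply: leq_sum => ? _); case: (_ < t).
Qed.

End Counting.

(** * Covers, heavy sets and light members *)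

Section Covers.

Variables (T : finType) (k t : nat) (F : {set {set T}}).
Hypothesis cF : forall A, A \in F -> #|A| = k.
Hypothesis tF : {in F &, forall A B, t <= #|A :&: B|}.
Implicit Types A B C E S U W : {set T}.

Let w := 'C(#|T| - t.+2, k - t.+2).
Let m := 'C(#|T| - t.+1, k - t.+1).

Definition cover_by W := [forall A in F, t <= #|A :&: W|].

Lemma cover_byP W : reflect {in F, forall A, t <= #|A :&: W|} (cover_by W).
Proof. exact: forall_inP. Qed.

Lemma member_cover A : A \in F -> cover_by A.
Proof. by move=> FA; apply/cover_byP => B FB; apply: tF. Qed.

Lemma star_noncover U b : ~~ cover_by U ->
  (forall x, x \notin U -> #|star F (x |: U)| <= b) -> #|star F U| <= k * b.
Proof.
rewrite negb_forall_in => /exists_inP[C FC]; rewrite -ltnNge => ltCU hb.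
apply: (card_star_extend _ ltCU _ hb) => [|A FA _]; last exact: tF.
by rewrite cF.
Qed.

(** While the set has fewer than [c] points it is not a cover, so each added point costs a factor
    [k]; at size [c] the binomial bound takes over. *)
Lemma star_below_covers c U : (forall W, #|W| < c -> ~~ cover_by W) ->
  #|U| <= c -> c <= k ->
  #|star F U| <= k ^ (c - #|U|) * 'C(#|T| - c, k - c).
Proof.
move=> hc leUc leck; move Ed : (c - #|U|) => d.
elim: d => [|d IH] in U leUc Ed *.
  have <- : #|U| = c by lia.
  by rewrite mul1n card_star_binomial //; lia.
rewrite expnS -mulnA; apply: star_noncover => [|x xU]; first by apply: hc; lia.
by apply: IH; rewrite cardsU1 xU; lia.
Qed.

(** Every member contains some [t]-subset of [W], and these subsets are extended up to the size of
    [W]. *)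
Lemma card_min_cover W : cover_by W ->
  (forall W', #|W'| < #|W| -> ~~ cover_by W') -> t <= #|W| <= k ->
  #|F| <= 'C(#|W|, t) * (k ^ (#|W| - t) * 'C(#|T| - #|W|, k - #|W|)).
Proof.
move=> /cover_byP covW minW /andP[tW Wk].
have sub : F \subset \bigcup_(E in [set E : {set T} | (E \subset W) && (#|E| == t)]) star F E.
  apply/subsetP => A FA.
  have : 0 < #|[set E : {set T} | (E \subset A :&: W) && (#|E| == t)]|.
    by rewrite cards_draws bin_gt0 covW.
  case/card_gt0P => E; rewrite inE subsetI => /andP[/andP[EA EW] cE].
  by apply/bigcupP; exists E; rewrite inE ?EW ?FA.
apply: leq_trans (subset_leq_card sub) _.
rewrite -cards_draws; apply: leq_card_bigcup => E.
rewrite inE => /andP[_ /eqP cE]; rewrite -{1}cE.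
by apply: star_below_covers => //; rewrite cE.
Qed.

Hypothesis ltk : t.+2 <= k.

(** The threshold is what [card_star_extend] yields when every one-point extension of [S] has a star
    of at most [w] members. *)
Definition heavy S := (#|S| == t.+1) && (k * w < #|star F S|).

Lemma card_heavy S : heavy S -> #|S| = t.+1.
Proof. by case/andP => /eqP. Qed.

Lemma star_kernel_extend S x : #|S| = t.+1 -> x \notin S ->
  #|star F (x |: S)| <= w.
Proof.
move=> cS xS; have := @card_star_binomial T k F (x |: S) cF.
by rewrite cardsU1 xS cS => ->.
Qed.

(** Otherwise [card_star_extend] would bound the star of [S] by [k * w]. It is applied first with
    [C] a member of [F], then with [C] another heavy set. *)
Lemma heavy_meets S C : heavy S -> #|C| <= k ->
  (forall A, A \in F -> t <= #|C :&: A|) -> t <= #|C :&: S|.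
Proof.
move=> /andP[/eqP cS hS] cC hC; rewrite leqNgt; apply: contraL hS => lt.
rewrite -leqNgt; apply: (card_star_extend cC lt) => [A FA _|x].
  exact: hC.
exact: star_kernel_extend.
Qed.

Lemma heavy_cover S : heavy S -> {in F, forall A, t <= #|A :&: S|}.
Proof.
move=> hS A FA; apply: heavy_meets => // [|B FB]; last exact: tF.
by rewrite cF.
Qed.

Lemma heavy_inter S S' : heavy S -> heavy S' -> t <= #|S :&: S'|.
Proof.
move=> hS hS'; apply: heavy_meets => // [|A FA]; last first.
  by rewrite setIC heavy_cover.
by rewrite (card_heavy hS); lia.
Qed.

Lemma card_star_light S : #|S| = t.+1 -> ~~ heavy S -> #|star F S| <= k * w.
Proof. by move=> cS; rewrite /heavy cS eqxx /= -leqNgt. Qed.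

Lemma card_star_kernel S : #|S| = t.+1 -> #|star F S| <= m.
Proof.
move=> cS; have := @card_star_binomial T k F S cF.
by rewrite cS; apply; lia.
Qed.

(** The set is [S1 :|: S2], and inclusion-exclusion over [S1] and [S2] drives both halves: it places
    [S3] inside [Y], and it settles the members of [F] that do not contain [S1 :&: S2]. *)
Lemma heavy_nonsunflower S1 S2 S3 : heavy S1 -> heavy S2 -> heavy S3 ->
  #|S1 :&: S2 :&: S3| < t ->
  exists2 Y : {set T}, #|Y| = t.+2 & {in F, forall A, t.+1 <= #|A :&: Y|}.
Proof.
move=> h1 h2 h3 lt.
have c1 := card_heavy h1; have c2 := card_heavy h2; have c3 := card_heavy h3.
have i12 := heavy_inter h1 h2.
have i13 := heavy_inter h3 h1; have i23 := heavy_inter h3 h2.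
pose E := S1 :&: S2; pose Y := S1 :|: S2.
have cE : #|E| = t.
  apply/eqP; rewrite eqn_leq i12 andbT -ltnS -c1 ltn_neqAle subset_leq_card ?subsetIl // andbT.
  (* With [t.+1] common points [S1] would lie in [S2], and the triple intersection would be
     [S1 :&: S3]. *)
  apply: contraTneq lt => eqc; rewrite -leqNgt.
  have /eqP -> : S1 :&: S2 == S1 by rewrite eqEcard subsetIl eqc leqnn.
  by rewrite setIC.
have cY : #|Y| = t.+2 by rewrite cardsU c1 c2 -/E cE; lia.
have sY : S3 \subset Y.
  have cU : #|S3 :&: Y| = #|S3 :&: S1| + #|S3 :&: S2| - #|S3 :&: E|.
    by rewrite setIUr cardsU setIACA setIid.
  have lt' : #|S3 :&: E| < t by rewrite setIC.
  have le : #|S3 :&: Y| <= #|S3| by rewrite subset_leq_card ?subsetIl.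
  apply/setIidPl/eqP; rewrite eqEcard subsetIl /=; lia.
exists Y => // A FA.
have cU : #|A :&: Y| = #|A :&: S1| + #|A :&: S2| - #|A :&: E|.
  by rewrite setIUr cardsU setIACA setIid.
have a1 := heavy_cover h1 FA; have a2 := heavy_cover h2 FA.
have [ltE|leE] := ltnP #|A :&: E| t; first by lia.
have EA : A :&: E = E by apply/eqP; rewrite eqEcard subsetIr cE leE.
(* Here [A] contains [E], which already gives [t] points of [Y]. One more comes from [S3], since [E]
   has fewer than [t] points in [S3]. *)
have /subsetPn[x xA xE] : ~~ (A :&: S3 \subset E).
  apply/negP => sub; have := heavy_cover h3 FA; rewrite leqNgt => /negP; apply.
  by apply: leq_ltn_trans lt; rewrite subset_leq_card // subsetI sub subsetIr.
have <- : #|x |: E| = t.+1 by rewrite cardsU1 xE cE.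
move: xA; rewrite inE => /andP[xA x3].
apply: subset_leq_card; rewrite subUset sub1set inE xA (subsetP sY) //=.
rewrite -EA setIS // /E /Y; apply: subset_trans (subsetIl _ _) (subsetUl _ _).
Qed.

Definition light := [set A in F | ~~ [exists S, heavy S && (S \subset A)]].

Lemma light_subset : light \subset F.
Proof. by apply/subsetP => A; rewrite inE => /andP[]. Qed.

Lemma light_triangle A B C :
  (forall S1 S2 S3, heavy S1 -> heavy S2 -> heavy S3 -> t <= #|S1 :&: S2 :&: S3|) ->
  A \in F -> B \in F -> C \in F -> #|A :&: B :&: C| < t ->
  [|| A \in light, B \in light | C \in light].
Proof.
move=> hsun FA FB FC; apply: contraTT; rewrite !inE FA FB FC /= !negb_or !negbK.
case/and3P=> /existsP[S1 /andP[h1 s1]] /existsP[S2 /andP[h2 s2]].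
case/existsP=> S3 /andP[h3 s3]; rewrite -leqNgt.
by apply: leq_trans (hsun _ _ _ h1 h2 h3) _; rewrite subset_leq_card ?setISS.
Qed.

Lemma card_light_star S : #|S| = t.+1 -> #|[set A in light | S \subset A]| <= k * w.
Proof.
move=> cS; have [hS|nS] := boolP (heavy S).
  rewrite (_ : [set _ in _ | _] = set0) ?cards0 //; apply/setP => A.
  rewrite !inE; apply/negP => /andP[/andP[_ /existsP nS] SA].
  by apply: nS; exists S; rewrite hS.
apply: leq_trans (card_star_light cS nS); apply: subset_leq_card.
by apply/subsetP => A; rewrite !inE => /andP[/andP[-> _] ->].
Qed.

(** A light member contains [W] or misses exactly one point [i] of it. In the second case [W :\ i]
    is not a cover, so some [C] in [F] forces a further point outside [W]; this gives a [(t+1)]-set,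
    through which at most [k * w] light members pass. *)
Lemma card_light W : cover_by W -> #|W| = t.+1 ->
  (forall E, #|E| = t -> ~~ cover_by E) ->
  #|light| <= (1 + t.+1 * (k - t)) * (k * w).
Proof.
move=> /cover_byP covW cW nocov.
pose X i := [set A in light | A :&: W == W :\ i].
have cX i : i \in W -> #|X i| <= (k - t) * (k * w).
  move=> iW; have cWi : #|W :\ i| = t.
    by have := cardsD1 i W; rewrite iW cW add1n => -[].
  have := nocov _ cWi; rewrite negb_forall_in => /exists_inP[C FC].
  rewrite -ltnNge => ltC.
  have sub : X i \subset \bigcup_(x in C :\: W) [set A in light | x |: (W :\ i) \subset A].
    apply/subsetP => A; rewrite inE => /andP[LA /eqP AW].
    have FA : A \in F by apply: (subsetP light_subset).
    have /subsetPn[x xAC xW] : ~~ (A :&: C \subset W).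
      apply/negP => sub; have := tF FA FC; rewrite leqNgt => /negP; apply.
      apply: leq_ltn_trans ltC; apply: subset_leq_card.
      by rewrite -AW setICA subsetI subsetIl /= subsetI subsetIr sub.
    move: xAC; rewrite inE => /andP[xA xC]; apply/bigcupP; exists x.
      by rewrite inE xW.
    by rewrite inE LA subUset sub1set xA -AW subsetIl.
  apply: leq_trans (subset_leq_card sub) _.
  apply: leq_trans (leq_card_bigcup (b := k * w) _) _.
    move=> x; rewrite inE => /andP[xW _]; apply: card_light_star.
    by rewrite cardsU1 cWi !inE (negPf xW) andbF.
  (* [W] takes at least [t] of the [k] points of [C], hence the factor [k - t]. *)
  rewrite leq_mul2r; apply/orP; right.
  by rewrite cardsD cF // leq_sub2l ?covW.
have sub : light \subset [set A in light | W \subset A] :|: \bigcup_(i in W) X i.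
  apply/subsetP => A LA; rewrite inE; apply/orP.
  have FA : A \in F by apply: (subsetP light_subset).
  have [WA|/subsetPn[i iW iA]] := boolP (W \subset A); [left|right].
    by rewrite inE LA.
  apply/bigcupP; exists i => //; rewrite inE LA /= eqEcard subsetD1 subsetIr !inE (negPf iA) /=.
  by have := cardsD1 i W; rewrite iW cW add1n => -[<-]; apply: covW.
apply: leq_trans (subset_leq_card sub) _.
apply: leq_trans (leq_card_setU _ _) _.
rewrite mulnDl mul1n leq_add ?card_light_star //.
by apply: leq_trans (leq_card_bigcup cX) _; rewrite cW mulnA.
Qed.

Lemma card_light_heavy : #|F| <= #|light| + #|[set S | heavy S]| * m.
Proof.
have sub : F \subset light :|: \bigcup_(S in [set S | heavy S]) star F S.
  apply/subsetP => A FA; rewrite !inE FA /=.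
  case: existsP => [[S /andP[hS SA]]|//] /=.
  by apply/bigcupP; exists S; rewrite inE ?FA.
apply: leq_trans (subset_leq_card sub) _; apply: leq_trans (leq_card_setU _ _) _.
rewrite leq_add2l; apply: leq_card_bigcup => S; rewrite inE => hS.
by rewrite card_star_kernel // card_heavy.
Qed.

End Covers.

(** * Heavy sets any three of which share a [t]-set, two of them being distinct *)

Section Sunflower.

Variables (T : finType) (k t : nat) (F : {set {set T}}).
Hypothesis cF : forall A, A \in F -> #|A| = k.
Hypothesis tF : {in F &, forall A B, t <= #|A :&: B|}.
Hypothesis ltk : t.+2 <= k.
Implicit Types A B C E S U W : {set T}.

Let w := 'C(#|T| - t.+2, k - t.+2).
Local Notation heavy := (heavy k t F).

Hypothesis hsun : forall S1 S2 S3, heavy S1 -> heavy S2 -> heavy S3 ->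
  t <= #|S1 :&: S2 :&: S3|.

Variables S1 S2 : {set T}.
Hypotheses (h1 : heavy S1) (h2 : heavy S2) (neq12 : S1 != S2).

Let E := S1 :&: S2.

Lemma card_core : #|E| = t.
Proof.
have c1 := card_heavy h1; have c2 := card_heavy h2.
have i12 : t <= #|E| := heavy_inter cF tF ltk h1 h2.
apply/eqP; rewrite eqn_leq i12 andbT leqNgt; apply: contraNN neq12 => lt.
have e1 : E = S1 by apply/eqP; rewrite eqEcard subsetIl c1.
by rewrite eqEcard -{1}e1 subsetIr c1 c2 leqnn.
Qed.

(** The common [t]-set of [S1], [S2] and [S] can only be [E]. Thus the heavy sets form a sunflower
    with kernel [E] and one-point petals. *)
Lemma heavy_core S : heavy S -> exists2 x, x \notin E & S = x |: E.
Proof.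
move=> hS; have ES : E \subset S.
  have := hsun h1 h2 hS; rewrite -/E -[X in X <= _]card_core => le.
  by apply/setIidPl/eqP; rewrite eqEcard subsetIl.
have /cards1P[x xE] : #|S :\: E| == 1.
  by rewrite cardsD (setIidPr ES) (card_heavy hS) card_core subSnn.
exists x; first by have := set11 x; rewrite -xE inE => /andP[].
by rewrite -xE -{1}(setID S E) (setIidPr ES) setUC.
Qed.

(** Every triangle has a member here, because [E] has [t] points; this is the hitting set for
    [ordered_triangles_hit]. *)
Definition off_core := [set C in F | ~~ (E \subset C)].

(** Without [x], the [t] points that [C] shares with the heavy set would make up all of [E]. *)
Lemma off_core_petal C x : C \in off_core -> heavy (x |: E) -> x \in C.
Proof.
rewrite inE => /andP[FC nEC] hS; apply: contraNT nEC => xC.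
have := heavy_cover cF tF ltk hS FC => le; apply/setIidPr/eqP.
rewrite eqEcard subsetIr card_core (leq_trans le) //.
rewrite subset_leq_card // setIUr subUset subxx andbT.
by apply/subsetP => y; rewrite !inE => /andP[yC /eqP yx]; rewrite -yx yC in xC.
Qed.

Lemma off_core_miss C : C \in off_core -> exists2 e, e \in E & E :\ e \subset C.
Proof.
move=> offC; have /andP[FC /subsetPn[e eE eC]] : (C \in F) && ~~ (E \subset C).
  by rewrite inE in offC.
exists e => //.
have [x xE S1E] := heavy_core h1.
have le : t <= #|C :&: (x |: E)| by rewrite -S1E (heavy_cover cF tF ltk h1 FC).
have sub : C :&: E \subset E :\ e.
  by rewrite subsetD1 subsetIr !inE (negPf eC).
have cEe : #|E :\ e|.+1 = t by rewrite -card_core (cardsD1 e E) eE.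
suff /eqP <- : C :&: E == E :\ e by rewrite subsetIl.
rewrite eqEcard sub -ltnS cEe (leq_trans le) // setIUr.
apply: leq_trans (leq_card_setU _ _) _; rewrite -add1n leq_add2r.
by rewrite -(cards1 x) subset_leq_card ?subsetIr.
Qed.

(** Such a member contains both petals and all of [E] but one point [e]. These [t.+1] points do not
    contain [E], so they are not heavy and their star is small. *)
Lemma card_off_core : #|off_core| <= t * (k * w).
Proof.
have [x1 x1E S1E] := heavy_core h1; have [x2 x2E S2E] := heavy_core h2.
have x12 : x1 != x2 by apply: contraNneq neq12 => x12; rewrite S1E S2E x12.
have sub : off_core \subset \bigcup_(e in E) star F (x1 |: (x2 |: (E :\ e))).
  apply/subsetP => C offC; have [e eE Ee] := off_core_miss offC.
  apply/bigcupP; exists e => //; rewrite inE !subUset !sub1set Ee.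
  rewrite !(off_core_petal offC) -?S1E -?S2E // !andbT.
  by move: offC; rewrite inE => /andP[].
apply: leq_trans (subset_leq_card sub) _; rewrite -[in t * _]card_core.
apply: leq_card_bigcup => e eE.
have cEe : #|E :\ e|.+1 = t by rewrite -card_core (cardsD1 e E) eE.
have cS : #|x1 |: (x2 |: (E :\ e))| = t.+1.
  by rewrite !cardsU1 in_setU1 !in_setD1 (negPf x1E) (negPf x2E) (negPf x12) !andbF -cEe.
apply: card_star_light => //; apply/negP => hS.
have := hsun h1 h2 hS; rewrite -/E leqNgt => /negP; apply.
rewrite -cEe ltnS subset_leq_card //; apply/subsetP => y.
rewrite in_setI => /andP[yE]; rewrite !in_setU1.
case/orP=> [/eqP yx|]; first by rewrite -yx yE in x1E.
by case/orP=> [/eqP yx|//]; rewrite -yx yE in x2E.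
Qed.

(** A third petal enlarges the forced set to [t.+2] points, which saves the factor [k]. *)
Lemma card_off_core3 S3 : heavy S3 -> S3 != S1 -> S3 != S2 ->
  #|off_core| <= t * w.
Proof.
move=> h3 neq31 neq32.
have [x1 x1E S1E] := heavy_core h1; have [x2 x2E S2E] := heavy_core h2.
have [x3 x3E S3E] := heavy_core h3.
have x12 : x1 != x2 by apply: contraNneq neq12 => x12; rewrite S1E S2E x12.
have x31 : x3 != x1 by apply: contraNneq neq31 => x31; rewrite S1E S3E x31.
have x32 : x3 != x2 by apply: contraNneq neq32 => x32; rewrite S2E S3E x32.
have sub : off_core \subset \bigcup_(e in E) star F (x3 |: (x1 |: (x2 |: (E :\ e)))).
  apply/subsetP => C offC; have [e eE Ee] := off_core_miss offC.
  apply/bigcupP; exists e => //; rewrite inE !subUset !sub1set Ee.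
  rewrite !(off_core_petal offC) -?S1E -?S2E -?S3E // !andbT.
  by move: offC; rewrite inE => /andP[].
apply: leq_trans (subset_leq_card sub) _; rewrite -[in t * _]card_core.
apply: leq_card_bigcup => e eE.
have cEe : #|E :\ e|.+1 = t by rewrite -card_core (cardsD1 e E) eE.
apply: star_kernel_extend => //.
  by rewrite !cardsU1 in_setU1 !in_setD1 (negPf x1E) (negPf x2E) (negPf x12) !andbF -cEe.
by rewrite !in_setU1 in_setD1 (negPf x31) (negPf x32) (negPf x3E) andbF.
Qed.

(** [C] contains the petal of every heavy set, and the petal determines the heavy set. *)
Lemma card_heavy_set C : C \in off_core -> #|[set S | heavy S]| <= k.
Proof.
move=> offC; have FC : C \in F by move: offC; rewrite inE => /andP[].
rewrite -[X in _ <= X](cF FC); apply: leq_trans (leq_imset_card (fun x => x |: E) C).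
apply: subset_leq_card; apply/subsetP => S; rewrite inE => hS.
have [x xE SE] := heavy_core hS; rewrite SE; apply: imset_f.
by apply: (off_core_petal offC); rewrite -SE.
Qed.

Lemma off_core_triangle A B C :
  A \in F -> B \in F -> C \in F -> #|A :&: B :&: C| < t ->
  [|| A \in off_core, B \in off_core | C \in off_core].
Proof.
move=> FA FB FC; apply: contraTT; rewrite !inE FA FB FC /= !negb_or !negbK.
case/and3P=> EA EB EC; rewrite -leqNgt -card_core subset_leq_card //.
by rewrite !subsetI EA EB EC.
Qed.

Lemma off_core_subset : off_core \subset F.
Proof. by apply/subsetP => A; rewrite inE => /andP[]. Qed.

End Sunflower.

(** * Binomial and arithmetic estimates *)

Section Numerics.

Variables n k t : nat.
Hypotheses (hk : 3 <= k) (hn : k ^ 4 <= n).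

Lemma ground_large : k ^ 3 + k <= n.
Proof. by rewrite (leq_trans _ hn) // !expnS expn0; nia. Qed.

Lemma kernel_count_gt0 : 0 < 'C(n - t.+1, k - t.+1).
Proof. by rewrite bin_gt0 leq_sub2r // (leq_trans _ ground_large) // leq_addl. Qed.

(** The bound of [card_min_cover] does not increase with the cover size: the ratio of consecutive
    terms is at most [k ^ 3 / (n - (t + s))], and [k ^ 3 + k <= n]. *)
Lemma cover_bound_decr s : 2 <= s -> t + s <= k ->
  'C(t + s, t) * (k ^ s * 'C(n - (t + s), k - (t + s))) <=
  'C(t.+2, t) * (k ^ 2 * 'C(n - t.+2, k - t.+2)).
Proof.
have large := ground_large.
elim: s => // s IH; rewrite leq_eqVlt => /orP[/eqP <-|s2] lts.
  by rewrite addn2.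
apply: leq_trans (IH _ _); [|lia..].
have b1 := mul_bin_down (t + s).+1 t.
have b2 := mul_bin_diag (n - (t + s)) (k - (t + s.+1)).
rewrite (_ : (n - (t + s)).-1 = n - (t + s.+1)) in b2; last by lia.
rewrite (_ : (k - (t + s.+1)).+1 = k - (t + s)) in b2; last by lia.
move: b1 b2; rewrite -addnS /=.
rewrite (_ : (t + s.+1).-1 = t + s); last by lia.
rewrite (_ : t + s.+1 - t = s.+1); last by lia.
move: 'C(t + s, t) 'C(t + s.+1, t) 'C(n - (t + s), _) 'C(n - (t + s.+1), _).
move=> a a' b b' e1 e2.
(* The product of the denominators in the two absorption identities [e1] and [e2]. *)
have pos : 0 < s.+1 * (n - (t + s)) by rewrite muln_gt0 /=; lia.
rewrite -(leq_pmul2l pos).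
have -> : s.+1 * (n - (t + s)) * (a' * (k ^ s.+1 * b')) =
          (s.+1 * a') * (k ^ s.+1 * ((n - (t + s)) * b')) by nia.
rewrite -e1 e2 expnS.
have -> : (t + s.+1) * a * (k * k ^ s * ((k - (t + s)) * b)) =
    ((t + s.+1) * k * (k - (t + s))) * (a * (k ^ s * b)) by nia.
rewrite leq_mul2r; apply/orP; right.
apply: (@leq_trans (k ^ 3)).
  rewrite !expnS expn0 muln1 -mulnA; apply: leq_mul => //.
  by apply: leq_mul => //; rewrite leq_subr.
by rewrite (@leq_trans (n - (t + s))) ?leq_pmull //; lia.
Qed.

Hypotheses (ht1 : 1 <= t) (ltk : t.+2 <= k).

(** Absorption gives [(n - t.+1) * w = (k - t.+1) * m], and [k - t.+1 <= k - 2]. Then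
    [(k - 2) * k ^ 2 * (k + 2)] is [k ^ 4 - 4 * k ^ 2], and the subtracted term leaves room for
    [t.+1]. *)
Lemma binomial_ratio :
  k ^ 2 * (k + 2) * 'C(n - t.+2, k - t.+2) <= 'C(n - t.+1, k - t.+1).
Proof.
have lekn := ground_large.
have K0 : 0 < k - t.+1 by lia.
have := mul_bin_diag (n - t.+1) (k - t.+2).
have -> : (n - t.+1).-1 = n - t.+2 by lia.
have -> : (k - t.+2).+1 = k - t.+1 by lia.
move: 'C(_, _) => w; move: 'C(_, _) => m eqwm.
rewrite -(leq_pmul2l K0) -eqwm mulnA leq_mul2r; apply/orP; right.
apply: (@leq_trans ((k - 2) * (k ^ 2 * (k + 2)))).
  by rewrite leq_mul2r; apply/orP; right; lia.
have [j kj] : exists j, k = j + 2 by exists (k - 2); lia.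
have e : k ^ 4 = (k - 2) * (k ^ 2 * (k + 2)) + 4 * k ^ 2.
  by rewrite kj addnK !expnS !expn0; lia.
have k2 : k <= k ^ 2 by rewrite -{1}(expn1 k) leq_pexp2l //; lia.
by move: hn; rewrite e; lia.
Qed.

End Numerics.

(* [l] bounds a part of the family hit by every triangle, [l0] its light members,
   and [h] counts the heavy sets. *)
Lemma hit_estimate t m o l f l0 h b : 0 < t -> 0 < m ->
  o <= 3 * (l * f ^ 2) -> f <= l0 + h * m -> 3 * l0 <= m -> h <= b ->
  (3 * b + 1) ^ 2 * l <= 8 * (t * m) -> 2 * o < t * t.+1 * t.+2 * m ^ 3.
Proof.
move=> t0 m0 ho hf hl0 hb hl.
have fm : 3 * f <= (3 * b + 1) * m.
  have : h * m <= b * m by rewrite leq_mul2r hb orbT.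
  by clear -hf hl0; lia.
have e1 : 3 * o <= (3 * b + 1) ^ 2 * l * m ^ 2.
  apply: (@leq_trans (l * (3 * f) ^ 2)).
    by rewrite expnMn; clear -ho; lia.
  rewrite -mulnA (mulnCA _ l) -expnMn leq_mul2l leq_exp2r //.
  by rewrite fm orbT.
have e2 : 3 * o <= 8 * (t * m ^ 3).
  apply: leq_trans e1 _.
  have -> : 8 * (t * m ^ 3) = 8 * (t * m) * m ^ 2 by rewrite (expnS m 2) !mulnA.
  by rewrite leq_mul2r hl orbT.
(* By [e2], [2 * o] is at most 16/3 times [t * m ^ 3]; the constant 6 makes the conclusion
   strict. *)
have Q6 : 6 * t <= t * t.+1 * t.+2 by clear -t0; nia.
have m30 : 0 < m ^ 3 by rewrite expn_gt0 m0.
have e3 : 6 * t * m ^ 3 <= t * t.+1 * t.+2 * m ^ 3 by rewrite leq_mul2r Q6 orbT.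
apply: leq_trans e3; have tM : 0 < t * m ^ 3 by rewrite muln_gt0 t0.
by move: (m ^ 3) e2 tM => M; clear; lia.
Qed.

(** * Too few triangles when any three heavy sets share a [t]-set *)

Section UpperBound.

Variables (T : finType) (k t : nat) (F : {set {set T}}).
Hypotheses (hk : 3 <= k) (ht1 : 1 <= t) (ltk : t.+2 <= k) (hn : k ^ 4 <= #|T|).
Hypothesis cF : forall A, A \in F -> #|A| = k.
Hypothesis tF : {in F &, forall A B, t <= #|A :&: B|}.

Let w := 'C(#|T| - t.+2, k - t.+2).
Let m := 'C(#|T| - t.+1, k - t.+1).

Let ratio : k ^ 2 * (k + 2) * w <= m.
Proof. exact: binomial_ratio. Qed.

Let m0 : 0 < m.
Proof. by apply: kernel_count_gt0. Qed.

Lemma ordered_triangles_no_small_cover :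
  F != set0 -> (forall W : {set T}, #|W| <= t.+1 -> ~~ cover_by t F W) ->
  2 * ordered_triangles t F < t * t.+1 * t.+2 * m ^ 3.
Proof.
case/set0Pn=> A0 FA0 nocov.
pose P c := [exists W : {set T}, (#|W| == c) && cover_by t F W].
(* Any member of [F] is a cover of size [k], so a minimum cover size exists and is at most [k]. *)
have exP : exists c, P c.
  exists k; apply/existsP; exists A0; rewrite (member_cover tF) // cF //.
  by rewrite eqxx.
case: (ex_minnP exP) => c /existsP[W /andP[/eqP cW covW]] minc.
have ltc : t.+1 < c.
  by rewrite ltnNge; apply: contraTN covW => le; apply: nocov; rewrite cW.
have lec : c <= k.
  apply: minc; apply/existsP; exists A0; rewrite (member_cover tF) // cF //.
  by rewrite eqxx.
have bound : 2 * #|F| <= t.+1 * m.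
  have minW (W' : {set T}) : #|W'| < #|W| -> ~~ cover_by t F W'.
    rewrite cW ltnNge; apply: contraNN => covW'.
    by apply: minc; apply/existsP; exists W'; rewrite eqxx.
  apply: (@leq_trans (2 * ('C(t.+2, t) * (k ^ 2 * w)))).
    rewrite leq_mul2l /=; apply: leq_trans (card_min_cover cF tF covW minW _) _.
      by rewrite cW lec andbT; lia.
    rewrite cW; have := @cover_bound_decr #|T| k t hk hn (c - t).
    by rewrite subnKC; [apply|]; lia.
  have -> : 2 * ('C(t.+2, t) * (k ^ 2 * w)) = t.+1 * (t.+2 * (k ^ 2 * w)).
    have -> : 'C(t.+2, t) = 'C(t.+2, 2) by rewrite -(@bin_sub t.+2 2) // !subSS subn0.
    have := mul_bin_diag t.+2 1; rewrite /= bin1.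
    by rewrite mulnA => <-; rewrite -mulnA mulnCA.
  (* Since [2 * 'C(t.+2, t)] is [t.+1 * t.+2], it remains to absorb [t.+2] into the factor [k + 2]
     of [ratio]. *)
  rewrite leq_mul2l /=; apply: leq_trans ratio.
  rewrite mulnA leq_mul2r; apply/orP; right; rewrite mulnC leq_mul2l.
  by apply/orP; right; lia.
have cube : 8 * #|F| ^ 3 <= t.+1 ^ 3 * m ^ 3.
  by rewrite (_ : 8 = 2 ^ 3) // -!expnMn leq_exp2r.
have le := ordered_triangles_cube t F.
have m30 : 0 < m ^ 3 by rewrite expn_gt0 m0.
move: (m ^ 3) (#|F| ^ 3) (ordered_triangles t F) m30 cube le => M f o M0 cube le.
have : 16 * o <= 2 * t.+1 ^ 3 * M by lia.
(* After cancelling [2 * t.+1] this is [t.+1 ^ 2 < 4 * t * t.+2]. *)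
have : 2 * t.+1 ^ 3 < 8 * (t * t.+1 * t.+2) by rewrite !expnS expn0; nia.
by nia.
Qed.

Lemma card_light_third W : cover_by t F W -> #|W| = t.+1 ->
  (forall E : {set T}, #|E| = t -> ~~ cover_by t F E) -> 3 * #|light k t F| <= m.
Proof.
move=> covW cW nocov.
have := card_light cF tF covW cW nocov; rewrite -/w => le.
apply: (@leq_trans (3 * ((1 + t.+1 * (k - t)) * (k * w)))).
  by rewrite leq_mul2l.
apply: leq_trans ratio.
have -> : 3 * ((1 + t.+1 * (k - t)) * (k * w)) =
    3 * (1 + t.+1 * (k - t)) * (k * w) by rewrite mulnA.
have -> : k ^ 2 * (k + 2) * w = k * (k + 2) * (k * w).
  by rewrite expnS expn1; lia.
rewrite leq_mul2r; apply/orP; right.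
(* With [t = a + 1] and [k = a + b + 3] the right side exceeds the left by
   [a * a + b * b - a * b + 2 * a + 2 * b]; equality holds for [k = 3], [t = 1]. *)
have [a ta] : exists a, t = a.+1 by exists t.-1; lia.
have [b kb] : exists b, k = t + b.+2 by exists (k - t.+2); lia.
rewrite kb addKn ta; have : a * b <= a * a + b * b by clear; nia.
by clear; lia.
Qed.

(** With at most one heavy set the light members are the hitting set; with two or more it is
    [off_core]. From three heavy sets on their number is only bounded by [k], which the sharper
    bound [t * w] on [off_core] pays for. *)
Lemma ordered_triangles_sunflower :
  (forall S1 S2 S3, heavy k t F S1 -> heavy k t F S2 -> heavy k t F S3 ->
     t <= #|S1 :&: S2 :&: S3|) ->
  2 * ordered_triangles t F < t * t.+1 * t.+2 * m ^ 3.
Proof.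
move=> hsun.
have m30 : 0 < m ^ 3 by rewrite expn_gt0 m0.
have [->|] := posnP (ordered_triangles t F).
  by rewrite muln0 muln_gt0 m30 andbT !muln_gt0 ht1.
rewrite lt0n sum_nat_eq0 negb_forall_in => /exists_inP[A0 FA0].
rewrite sum_nat_eq0 negb_forall_in => /exists_inP[B0 FB0].
rewrite sum_nat_eq0 negb_forall_in => /exists_inP[C0 FC0].
rewrite eqb0 negbK => tri0.
(* A cover with at most [t] points has exactly [t] and lies in every member, so the triangle [A0],
   [B0], [C0] would share [t] points. *)
have nocov (E : {set T}) : #|E| <= t -> ~~ cover_by t F E.
  move=> cE; apply: contraTN tri0 => /cover_byP cov; rewrite -leqNgt.
  have sE A : A \in F -> E \subset A.
    move=> FA; apply/setIidPr/eqP.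
    by rewrite eqEcard subsetIr (leq_trans cE) ?cov.
  apply: leq_trans (cov _ FA0) _; apply: subset_leq_card.
  by apply: subset_trans (subsetIr _ _) _; rewrite !subsetI !sE.
have [|/existsPn nocov'] := boolP [exists W : {set T}, (#|W| == t.+1) && cover_by t F W]; last first.
  apply: ordered_triangles_no_small_cover => [|W].
    by apply/set0Pn; exists A0.
  rewrite leq_eqVlt => /orP[cW|]; last exact: nocov.
  by have := nocov' W; rewrite cW.
case/existsP=> W /andP[/eqP cW covW].
have light3 : 3 * #|light k t F| <= m.
  by apply: card_light_third covW cW _ => E cE; apply: nocov; rewrite cE.
have := card_light_heavy cF ltk; rewrite -/m => Fle.
set H := [set S | heavy k t F S] in Fle.
have [le1|] := leqP #|H| 1.
  have le := ordered_triangles_hit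
    (fun A B C => light_triangle hsun (A := A) (B := B) (C := C))
    (light_subset k t F).
  apply: (hit_estimate ht1 m0 le Fle light3 le1).
  by move: light3 ht1; clear; move: m #|light _ _ _| => a b; nia.
case/card_gt1P => S1 [S2 [h1 h2 neq12]]; rewrite !inE in h1 h2.
have := off_core_triangle cF tF ltk h1 h2 neq12.
set L := off_core F S1 S2 => hitL.
have := ordered_triangles_hit hitL (off_core_subset F S1 S2); rewrite -/L => le.
(* The fixed triangle provides an off-core member, which [card_heavy_set] needs. *)
have [C LC] : exists C, C \in L.
  by case/or3P: (hitL _ _ _ FA0 FB0 FC0 tri0) => h; eexists; apply: h.
have [/existsP[S3 /and3P[h3 n31 n32]]|] :=
    boolP [exists S3, [&& heavy k t F S3, S3 != S1 & S3 != S2]].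
  have Lw := card_off_core3 cF tF ltk hsun h1 h2 neq12 h3 n31 n32.
  have Hk := card_heavy_set cF tF ltk hsun h1 h2 neq12 LC.
  apply: (hit_estimate ht1 m0 le Fle light3 Hk).
  have e : (3 * k + 1) ^ 2 <= 8 * (k ^ 2 * (k + 2)).
    by rewrite !expnS !expn0; clear -hk; nia.
  apply: (@leq_trans (8 * (k ^ 2 * (k + 2)) * (t * w))); first exact: leq_mul.
  by rewrite -mulnA leq_mul2l /= mulnCA leq_mul2l ratio orbT.
move=> /existsPn noS3.
have Lw := card_off_core cF tF ltk hsun h1 h2 neq12.
have H2 : #|H| <= 2.
  apply: (@leq_trans #|[set S1; S2]|); last by rewrite cards2; case: (_ != _).
  apply: subset_leq_card; apply/subsetP => S; rewrite !inE => hS.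
  by have := noS3 S; rewrite hS /= negb_and !negbK.
apply: (hit_estimate ht1 m0 le Fle light3 H2).
have e : (3 * 2 + 1) ^ 2 <= 8 * (k * (k + 2)) by clear -hk; nia.
apply: (@leq_trans (8 * (k * (k + 2)) * (t * (k * w)))); first exact: leq_mul.
have -> : 8 * (k * (k + 2)) * (t * (k * w)) = 8 * (t * (k ^ 2 * (k + 2) * w)).
  by rewrite expnS expn1; move: w; clear; lia.
by rewrite leq_mul2l /= leq_mul2l ratio orbT.
Qed.

End UpperBound.

(** * The extremal family over an arbitrary core [Y] of [t + 2] points *)

Section Frankl.

Variables (T : finType) (k t : nat) (Y : {set T}).
Hypothesis cY : #|Y| = t.+2.
Implicit Types (A B C J X : {set T}) (F : {set {set T}}).

Definition frankl := [set A : {set T} | (#|A| == k) && (#|A :&: Y| == t.+1)].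

Lemma card_meet_core A B : t < #|A :&: Y| -> t < #|B :&: Y| ->
  t <= #|A :&: B :&: Y|.
Proof.
move=> hA hB; have := cardsUI (A :&: Y) (B :&: Y); rewrite setIACA setIid.
have : #|(A :&: Y) :|: (B :&: Y)| <= #|Y| by rewrite subset_leq_card // subUset !subsetIr.
rewrite cY; lia.
Qed.

Lemma core_t_intersecting F :
  {in F, forall A, t < #|A :&: Y|} -> t_intersecting t F.
Proof.
move=> hF; apply/t_intersectingP => A B FA FB.
apply: leq_trans (card_meet_core (hF A FA) (hF B FB)) _.
by rewrite subset_leq_card ?subsetIl.
Qed.

Lemma frankl_core A : A \in frankl -> t < #|A :&: Y|.
Proof. by rewrite inE => /andP[_ /eqP ->]. Qed.

Lemma frankl_t_intersecting : t_intersecting t frankl.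
Proof. exact/core_t_intersecting/frankl_core. Qed.

(** If [A] contained [Y], it would contain the [t] points or more that [B] and [C] share inside
    [Y]. *)
Lemma frankl_triangle F A B C :
  {in F, forall A, #|A| = k} -> {in F, forall A, t < #|A :&: Y|} ->
  A \in F -> B \in F -> C \in F -> #|A :&: B :&: C| < t -> A \in frankl.
Proof.
move=> cF hF FA FB FC; apply: contraTT; rewrite inE cF // eqxx /= => neq.
have YA : Y \subset A.
  apply/setIidPr/eqP; rewrite eqEcard subsetIr cY.
  by rewrite ltn_neqAle eq_sym neq hF.
rewrite -leqNgt; apply: leq_trans (card_meet_core (hF B FB) (hF C FC)) _.
apply: subset_leq_card; apply/subsetP => x; rewrite !inE.
by case/andP=> [/andP[-> ->] /(subsetP YA) ->].
Qed.

Lemma triangles_frankl F :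
  {in F, forall A, #|A| = k} -> {in F, forall A, t < #|A :&: Y|} ->
  [set S : {set {set T}} | (S \subset F) && triangle 2 t S] \subset
  [set S : {set {set T}} | (S \subset frankl) && triangle 2 t S].
Proof.
move=> cF hF; apply/subsetP => S; rewrite !inE => /andP[SF tri].
rewrite tri andbT; apply/subsetP => A SA.
have /and3P[/eqP cS _ lt] := tri.
have /cards2P[B [C [BC SE]]] : #|S :\ A| == 2.
  by have := cardsD1 A S; rewrite SA cS => -[]; rewrite add0n => <-.
have [SB SC] : B \in S /\ C \in S.
  have := set21 B C; have := set22 B C; rewrite -SE !inE.
  by move=> /andP[_ ->] /andP[_ ->].
have eqS : S = [set A; B; C] by rewrite -(setD1K SA) SE setUA.
apply: (frankl_triangle (F := F) (B := B) (C := C)) => //; try exact: (subsetP SF).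
by move: lt; rewrite {1}eqS bigcap_set3.
Qed.

Lemma num_triangles_frankl F :
  {in F, forall A, #|A| = k} -> {in F, forall A, t < #|A :&: Y|} ->
  num_triangles 2 t F <= num_triangles 2 t frankl.
Proof. by move=> cF hF; apply/subset_leq_card/triangles_frankl. Qed.

Lemma num_triangles_frankl_sub F :
  {in F, forall A, #|A| = k} -> {in F, forall A, t < #|A :&: Y|} ->
  frankl \subset F -> num_triangles 2 t F = num_triangles 2 t frankl.
Proof.
move=> cF hF sF; apply/eqP; rewrite eqn_leq num_triangles_frankl //=.
apply: subset_leq_card; apply/subsetP => S; rewrite !inE => /andP[sS ->].
by rewrite (subset_trans sS).
Qed.

Lemma card_missing J C : C \in frankl -> J \subset Y -> Y :\: C \subset J ->
  #|J :&: C|.+1 = #|J|.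
Proof.
rewrite inE => /andP[_ /eqP cC] JY CJ; rewrite -addn1.
have <- : #|J :\: C| = 1.
  have -> : J :\: C = Y :\: C.
    apply/eqP; rewrite eqEsubset setSD //=; apply/subsetP => x xYC.
    by rewrite inE (subsetP CJ) // andbT; move: xYC; rewrite inE => /andP[].
  by rewrite cardsD setIC cC cY subSnn.
exact: cardsID.
Qed.

Hypotheses (hk : 3 <= k) (ht1 : 1 <= t) (ltk : t.+2 <= k) (hn : k ^ 4 <= #|T|).

Let w := 'C(#|T| - t.+2, k - t.+2).
Let m := 'C(#|T| - t.+1, k - t.+1).

(** Serves to build triangles one member at a time: [J] holds the points of [Y] common to the
    members chosen so far, and the next member misses one of them. The condition on [X] excludes
    common points outside [Y]. *)
Definition frankl_avoiding J X :=
  [set C in frankl | (Y :\: C \subset J) && (C :&: X \subset Y)].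

Lemma card_frankl_type l X : l \in Y -> #|X :\: Y| < k ->
  m - k * w <=
  #|[set C : {set T} | [&& #|C| == k, Y :\: C == [set l] & C :&: X \subset Y]]|.
Proof.
move=> lY cX; set P := [set _ | _].
have cYl : #|Y :\ l| = t.+1 by have := cardsD1 l Y; rewrite lY cY => -[].
pose sup (U : {set T}) := [set A : {set T} | (#|A| == k) && (U \subset A)].
have csup : #|sup (Y :\ l)| = m by rewrite card_supersets cYl //; lia.
have sub : sup (Y :\ l) \subset
    P :|: (sup Y :|: \bigcup_(x in X :\: Y) sup (x |: Y :\ l)).
  apply/subsetP => C; rewrite inE => /andP[cC sC].
  have [lC|lC] := boolP (l \in C).
    by rewrite !inE cC -(setD1K lY) subUset sub1set lC sC orbT.
  have YC : Y :\: C == [set l].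
    rewrite eqEsubset sub1set inE lC lY !andbT; apply/subsetP => x.
    rewrite !inE => /andP[xC xY]; apply: contraNT xC => xl.
    by rewrite (subsetP sC) // !inE xl.
  have [CX|/subsetPn[x]] := boolP (C :&: X \subset Y).
    by rewrite !inE cC YC CX.
  rewrite inE => /andP[xC xX] xY; rewrite !in_setU; apply/orP; right.
  apply/orP; right; apply/bigcupP; exists x; first by rewrite inE xY.
  by rewrite inE cC subUset sub1set xC.
rewrite leq_subLR -csup; apply: leq_trans (subset_leq_card sub) _.
apply: leq_trans (leq_card_setU _ _) _; rewrite addnC leq_add2r.
apply: leq_trans (leq_card_setU _ _) _.
apply: (@leq_trans (w + #|X :\: Y| * w)); last first.
  by rewrite -mulSn leq_mul2r cX orbT.
apply: leq_add; first by rewrite card_supersets cY.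
apply: leq_card_bigcup => x; rewrite inE => /andP[xY _].
have cx : #|x |: Y :\ l| = t.+2 by rewrite cardsU1 cYl !inE (negPf xY) andbF.
by rewrite card_supersets cx.
Qed.

Lemma card_frankl_avoiding J X : J \subset Y -> #|X :\: Y| < k ->
  #|J| * (m - k * w) <= #|frankl_avoiding J X|.
Proof.
move=> JY cX; rewrite -sum_nat_const.
pose P l := [set C : {set T} | [&& #|C| == k, Y :\: C == [set l] & C :&: X \subset Y]].
apply: (@leq_trans (\sum_(l in J) #|P l|)).
  by apply: leq_sum => l lJ; apply: card_frankl_type; rewrite ?(subsetP JY).
have PG l : l \in J -> P l \subset frankl_avoiding J X.
  move=> lJ; apply/subsetP => C; rewrite !inE => /and3P[-> /eqP YC ->].
  rewrite YC sub1set lJ /= andbT; have := cardsID C Y.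
  by rewrite YC cards1 cY setIC addn1 => -[->].
have -> : \sum_(l in J) #|P l| =
    \sum_(l in J) \sum_(C in frankl_avoiding J X) (C \in P l).
  apply: eq_bigr => l lJ; rewrite -sum1_card big_mkcond [RHS]big_mkcond /=.
  apply: eq_bigr => C _.
  by case: (boolP (C \in P l)) => [/(subsetP (PG l lJ)) -> //|_]; case: ifP.
apply: (@leq_trans (\sum_(C in frankl_avoiding J X) 1)); last by rewrite sum1_card.
(* The classes [P l] are disjoint: [C] misses a single point of [Y], hence lies in at most one of
   them. *)
rewrite exchange_big /=; apply: leq_sum => C avC.
have <- : #|Y :\: C| = 1.
  move: avC; rewrite !inE => /andP[/andP[_ /eqP cC] _].
  by rewrite cardsD setIC cC cY subSnn.
rewrite -sum1_card big_mkcond [leqRHS]big_mkcond /=; apply: leq_sum => l _.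
case: ifP => // _; case: (boolP (C \in P l)) => //.
by rewrite inE => /and3P[_ /eqP -> _]; rewrite inE eqxx.
Qed.

Lemma card_setcond (G : {set {set T}}) (P : pred {set T}) :
  #|[set C in G | P C]| = \sum_(C in G) (P C : nat).
Proof.
rewrite -sum1_card big_mkcond [RHS]big_mkcond /=; apply: eq_bigr => C _.
by rewrite inE; case: (C \in G); case: (P C).
Qed.

Lemma frankl_outside A : A \in frankl -> #|A :\: Y| < k.
Proof. by rewrite inE => /andP[/eqP cA /eqP cAY]; rewrite cardsD cA cAY; lia. Qed.

(** The three sets miss three different points of [Y], which leaves [t - 1] common points there, and
    [C] meets [A] only inside [Y]. *)
Lemma frankl_avoiding_triangle A B C : A \in frankl ->
  B \in frankl_avoiding (Y :&: A) set0 -> C \in frankl_avoiding (Y :&: A :&: B) A ->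
  #|A :&: B :&: C| < t.
Proof.
move=> GA; rewrite inE => /and3P[GB BA _]; rewrite inE => /and3P[GC CAB CA].
have cA : #|Y :&: A| = t.+1 by move: GA; rewrite setIC inE => /andP[_ /eqP].
have := card_missing GB (subsetIl _ _) BA; rewrite cA => -[cAB].
have := card_missing GC (subset_trans (subsetIl _ _) (subsetIl _ _)) CAB.
rewrite cAB => <-; rewrite ltnS; apply: subset_leq_card.
apply/subsetP => x; rewrite !inE => /andP[/andP[xA xB] xC].
by rewrite xA xB xC !andbT (subsetP CA) // inE xC.
Qed.

(** Greedy choice: the missing points of [A], [B], [C] can be picked in [t.+2], [t.+1] and [t] ways,
    each with at least [M] sets. *)
Lemma ordered_triangles_frankl :
  t * t.+1 * t.+2 * (m - k * w) ^ 3 <= ordered_triangles t frankl.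
Proof.
set M := m - k * w.
have cMt X : X \subset Y -> #|X| * M <= #|frankl_avoiding X set0|.
  by move=> XY; apply: card_frankl_avoiding; rewrite // set0D cards0; lia.
have cG : t.+2 * M <= #|frankl|.
  rewrite -cY; apply: leq_trans (cMt _ (subxx Y)) _; apply: subset_leq_card.
  by apply/subsetP => C; rewrite inE => /andP[].
apply: (@leq_trans (\sum_(A in frankl) (t.+1 * M) * (t * M))).
  rewrite sum_nat_const; apply: leq_trans (leq_mul cG (leqnn _)).
  by rewrite !expnS expn0; clear; lia.
apply: leq_sum => A GA.
have cA : #|Y :&: A| = t.+1 by move: GA; rewrite setIC inE => /andP[_ /eqP].
have cB := cMt _ (subsetIl Y A); rewrite cA in cB.
apply: leq_trans (leq_mul cB (leqnn _)) _.
rewrite card_setcond big_distrl /=; apply: leq_sum => B GB.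
case: (boolP (_ && _)) => [avB|_]; last by rewrite mul0n.
rewrite mul1n.
have avB' : B \in frankl_avoiding (Y :&: A) set0 by rewrite inE GB.
have /andP[BA _] := avB.
have := card_missing GB (subsetIl _ _) BA; rewrite cA => -[cAB].
have := card_frankl_avoiding (subset_trans (subsetIl (Y :&: A) B) (subsetIl _ _)) (frankl_outside GA).
rewrite cAB -/M => cC; apply: leq_trans cC _.
rewrite card_setcond; apply: leq_sum => C GC.
case: (boolP (_ && _)) => // avC.
by rewrite (frankl_avoiding_triangle GA avB') // inE GC.
Qed.

(** The constant is the value of [k * (k + 2)] at [k = 3]. *)
Lemma frankl_slack : 15 * (k * w) <= m.
Proof.
apply: leq_trans (binomial_ratio hk hn ht1 ltk); rewrite -/w.
rewrite mulnA leq_mul2r; apply/orP; right.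
by rewrite expnS expn1; clear -hk; nia.
Qed.

(** At least 14/15 of [m] survives, and the cube of 14/15 exceeds one half. *)
Lemma ordered_triangles_frankl_half :
  t * t.+1 * t.+2 * m ^ 3 <= 2 * ordered_triangles t frankl.
Proof.
apply: (@leq_trans (2 * (t * t.+1 * t.+2 * (m - k * w) ^ 3))); last first.
  by rewrite leq_mul2l ordered_triangles_frankl.
rewrite mulnCA leq_mul2l; apply/orP; right.
have h : 14 * m <= 15 * (m - k * w) by have := frankl_slack; clear; lia.
have : 14 ^ 3 * m ^ 3 <= 15 ^ 3 * (m - k * w) ^ 3 by rewrite -!expnMn leq_exp2r.
by move: (m ^ 3) ((m - _) ^ 3) => a b; clear; lia.
Qed.

Lemma frankl_in_triangle A : A \in frankl ->
  exists B C, [/\ B \in frankl, C \in frankl & #|A :&: B :&: C| < t].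
Proof.
move=> GA; have M0 : 0 < m - k * w.
  have m0 : 0 < m by apply: kernel_count_gt0.
  by have := frankl_slack; move: m0; clear; lia.
have cA : #|Y :&: A| = t.+1 by move: GA; rewrite setIC inE => /andP[_ /eqP].
have [B avB] : exists B, B \in frankl_avoiding (Y :&: A) set0.
  apply/card_gt0P; apply: leq_trans (card_frankl_avoiding (subsetIl _ _) _).
    by rewrite cA muln_gt0 M0.
  by rewrite set0D cards0; lia.
have /and3P[GB BA _] : [&& B \in frankl, Y :\: B \subset Y :&: A & B :&: set0 \subset Y].
  by rewrite inE in avB.
have := card_missing GB (subsetIl _ _) BA; rewrite cA => -[cAB].
have [C avC] : exists C, C \in frankl_avoiding (Y :&: A :&: B) A.
  apply/card_gt0P; apply: leq_trans (card_frankl_avoiding _ (frankl_outside GA)).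
    by rewrite cAB muln_gt0 M0 ht1.
  exact: subset_trans (subsetIl _ _) (subsetIl _ _).
exists B, C; split => //; first by move: avC; rewrite inE => /andP[].
exact: frankl_avoiding_triangle GA avB avC.
Qed.

(** The triangles of [F] are among those of [frankl], so equal numbers mean equal sets of triangles;
    each member of [frankl] lies in one of them. *)
Lemma num_triangles_frankl_eq F :
  {in F, forall A, #|A| = k} -> {in F, forall A, t < #|A :&: Y|} ->
  num_triangles 2 t F = num_triangles 2 t frankl -> frankl \subset F.
Proof.
move=> cF hF eqN; apply/subsetP => A GA.
have eqT : [set S : {set {set T}} | (S \subset F) && triangle 2 t S] =
           [set S : {set {set T}} | (S \subset frankl) && triangle 2 t S].
  apply/eqP; rewrite eqEcard triangles_frankl //=.
  by move: eqN; rewrite /num_triangles => ->.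
have [B [C [GB GC lt]]] := frankl_in_triangle GA.
have [AB AC BC] := triangle_distinct frankl_t_intersecting GA GB GC lt.
have : [set A; B; C] \in [set S : {set {set T}} | (S \subset frankl) && triangle 2 t S].
  have sG : [set A; B; C] \subset frankl by rewrite !subUset !sub1set GA GB GC.
  by rewrite inE sG (triangle2E frankl_t_intersecting) ?cards3 // bigcap_set3.
by rewrite -eqT inE => /andP[/subsetP/(_ A) ->] //; rewrite !inE eqxx.
Qed.

End Frankl.

(** * Permutations of the ground set *)

Section Isomorphism.

Variable T : finType.
Implicit Types (Y Z : {set T}) (F : {set {set T}}).

(** List [Y] and then its complement, do the same for [Z], and match equal positions. *)
Lemma perm_image_set Y Z : #|Y| = #|Z| -> exists s : {perm T}, s @: Y = Z.
Proof.
move=> cYZ; pose sq (X : {set T}) := enum X ++ enum (~: X).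
have usq X : uniq (sq X).
  rewrite cat_uniq !enum_uniq andbT; apply/hasPn => x.
  by rewrite !mem_enum inE.
have msq X x : x \in sq X by rewrite mem_cat !mem_enum inE orbN.
have ssq X : size (sq X) = #|T| by rewrite size_cat -!cardE cardsC.
pose f x := nth x (sq Z) (index x (sq Y)).
have ix x : index x (sq Y) < size (sq Z) by rewrite ssq -(ssq Y) index_mem.
have inj_f : injective f.
  move=> x y; rewrite /f (set_nth_default x y) // => /eqP.
  by rewrite nth_uniq // => /eqP/index_inj ->.
exists (perm inj_f); apply/eqP; rewrite eqEcard card_imset; last exact: perm_inj.
rewrite cYZ leqnn andbT; apply/subsetP => _ /imsetP[x xY ->]; rewrite permE /f.
have xi : index x (sq Y) < size (enum Z).
  by rewrite index_cat mem_enum xY -cardE -cYZ cardE index_mem mem_enum.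
by rewrite nth_cat xi -mem_enum mem_nth.
Qed.

Lemma num_triangles_perm (s : {perm T}) t F : t_intersecting t F ->
  num_triangles 2 t [set s @: A | A : {set T} in F] = num_triangles 2 t F.
Proof.
move=> tF; have /t_intersectingP tFP := tF.
have cI (A B : {set T}) : #|s @: A :&: s @: B| = #|A :&: B|.
  by rewrite -imsetI ?card_imset //; [exact: perm_inj|move=> x y _ _ /perm_inj].
have tF' : t_intersecting t [set s @: A | A : {set T} in F].
  apply/t_intersectingP => _ _ /imsetP[A FA ->] /imsetP[B FB ->].
  by rewrite cI tFP.
have inj : {in F &, injective (fun A : {set T} => s @: A)}.
  by move=> A B _ _; apply: imset_inj; apply: perm_inj.
apply/eqP; rewrite -(eqn_pmul2l (isT : 0 < 6)) -!ordered_trianglesE //.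
rewrite /ordered_triangles big_imset //=; apply/eqP; apply: eq_bigr => A FA.
rewrite big_imset //=; apply: eq_bigr => B FB.
rewrite big_imset //=; apply: eq_bigr => C FC.
by rewrite -imsetI ?cI // => x y _ _ /perm_inj.
Qed.

End Isomorphism.

(** * The core [[t + 2]], the bound and the equality case *)

Lemma card_init_seg n j : j <= n -> #|init_seg n j| = j.
Proof.
move=> lejn; have inj : injective (widen_ord lejn).
  by move=> x y /(congr1 val) /= /val_inj.
rewrite -[RHS]card_ord -(card_imset _ inj); apply: eq_card => i; rewrite inE; apply/idP/imsetP => [ij|[x _ ->]] //=.
by exists (Ordinal ij) => //; apply: val_inj.
Qed.

Lemma G_famE n k t : G_fam n k 2 t = frankl k t (init_seg n (2 + t)).
Proof. by apply/setP => A; rewrite !inE add2n subn1. Qed.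

Theorem theorem1p3 (n k t : nat) (F : {set {set 'I_n}})
  (hk : 3 <= k) (ht1 : 1 <= t) (htk : t <= k - 2) (hn : k ^ 4 <= n)
  (hF : F \subset ksubsets n k) (hint : t_intersecting t F) :
  num_triangles 2 t F <= num_triangles 2 t (G_fam n k 2 t) /\
  (num_triangles 2 t F = num_triangles 2 t (G_fam n k 2 t) <->
   exists F' : {set {set 'I_n}},
     [/\ isomorphic F F', G_fam n k 2 t \subset F' & F' \subset G'_fam n k 2 t]).
Proof.
have ltk : t.+2 <= k by lia.
have hn' : k ^ 4 <= #|'I_n| by rewrite card_ord.
pose Y := init_seg n (2 + t).
have cY : #|Y| = t.+2.
  by rewrite card_init_seg //; have := ground_large hk hn; lia.
have cF : {in F, forall A : {set 'I_n}, #|A| = k}.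
  by move=> A /(subsetP hF); rewrite inE => /eqP.
have tF := t_intersectingP _ _ hint.
have inG' (F' : {set {set 'I_n}}) : F' \subset G'_fam n k 2 t ->
    {in F', forall A : {set 'I_n}, #|A| = k} /\ {in F', forall A : {set 'I_n}, t < #|A :&: Y|}.
  move=> sF'; split=> A /(subsetP sF'); rewrite inE => /andP[] //.
  by rewrite inE => /eqP.
have backward : (exists F' : {set {set 'I_n}},
    [/\ isomorphic F F', frankl k t Y \subset F' & F' \subset G'_fam n k 2 t]) ->
    num_triangles 2 t F = num_triangles 2 t (frankl k t Y).
  move=> [F' [[s F'E] GF' /inG'[cF' hF']]].
  rewrite -(num_triangles_frankl_sub cY cF' hF' GF') F'E.
  by rewrite num_triangles_perm.
rewrite G_famE -/Y.
(* Either three heavy sets share fewer than [t] points, and [F] has a core of [t.+2] points, or the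
   inequality is strict and equality cannot occur. *)
have [/existsP[S1 /existsP[S2 /existsP[S3 /and4P[h1 h2 h3 lt]]]]|nosun] :=
    boolP [exists S1, exists S2, exists S3, [&& heavy k t F S1, heavy k t F S2,
      heavy k t F S3 & #|S1 :&: S2 :&: S3| < t]]; last first.
  have lt : num_triangles 2 t F < num_triangles 2 t (frankl k t Y).
    (* The 6 turns both counts into ordered ones; the 2 matches the half in the lower bound for
       [frankl]. *)
    rewrite -(ltn_pmul2l (isT : 0 < 2 * 6)) -!mulnA.
    rewrite -!ordered_trianglesE //; last exact: frankl_t_intersecting.
    apply: leq_trans (ordered_triangles_frankl_half cY hk ht1 ltk hn').
    apply: ordered_triangles_sunflower => // S1 S2 S3 h1 h2 h3.
    rewrite leqNgt; apply: contraNN nosun => lt; apply/existsP; exists S1.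
    apply/existsP; exists S2; apply/existsP; exists S3.
    by rewrite h1 h2 h3.
  split; first exact: ltnW.
  by split=> // eqN; rewrite eqN ltnn in lt.
have [Z cZ hZ] := heavy_nonsunflower cF tF ltk h1 h2 h3 lt.
have [s sZ] : exists s : {perm 'I_n}, s @: Z = Y.
  by apply: perm_image_set; rewrite cZ cY.
(* Moving the core [Z] onto [Y] makes [F'] comparable with the standard families; it is also the
   witness for the equality case. *)
pose F' := [set s @: A | A : {set 'I_n} in F].
have F'G' : F' \subset G'_fam n k 2 t.
  apply/subsetP => _ /imsetP[A FA ->]; rewrite !inE -/Y -sZ add2n subn1.
  rewrite -imsetI; last by move=> x y _ _ /perm_inj.
  by rewrite !(card_imset _ (@perm_inj _ s)) (cF A FA) eqxx; apply: hZ.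
have [cF' hF'] := inG' F' F'G'.
have NF' : num_triangles 2 t F' = num_triangles 2 t F by apply: num_triangles_perm.
split; first by rewrite -NF' num_triangles_frankl.
split=> [eqN|//]; exists F'; split=> //; first by exists s.
by apply: num_triangles_frankl_eq; rewrite ?NF'.
Qed.
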